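(* Let $G=\mathbb R^r=M$ (with $G$ the additive group), acting on $M$ by $(\epsilon,z)\mapsto z+\epsilon$, i.e. in coordinates $$(\epsilon_1,\dots,\epsilon_r)\cdot(z_1,\dots,z_r)=(\epsilon_1+z_1,\dots,\epsilon_r+z_r).$$ Then the Poisson structure matrix $[\Lambda]$ of this action on $M\times\mathfrak g^*$ is $$[\Lambda]=\begin{pmatrix}0&I_r\\-I_r&0\end{pmatrix},$$ where $I_r$ is the $r\times r$ identity matrix.
   Context: For a left action of a Lie group $G$ (dimension $r$, Lie algebra $\mathfrak g$ with basis $v_1,\dots,v_r$) on a manifold $M$ with coordinates $z=(z^1,\dots,z^p)$, the matrix of infinitesimals is the $p\times r$ matrix $\Phi$ with $\Phi_{\ell k}(z)=\frac{d}{dt}|_{t=0}(\exp(tv_k)\cdot z)^\ell$. Let $\xi_1,\dots,\xi_r$ be the coordinates on $\mathfrak g^*$ given by $\xi_i(\theta)=\theta(v_i)$, and let $\Lambda(\mathfrak g^* )$ be the Lie Poisson structure matrix with entries $\sum_kc_{ij}^k\xi_k$, where $[v_i,v_j]=\sum_kc_{ij}^kv_k$. The Poisson structure matrix of the action on $M\times\mathfrak g^*$, in the coordinates $(z,\xi)$, is $$[\Lambda]=\begin{pmatrix}0&\Phi\\-\Phi^T&\Lambda(\mathfrak g^* )\end{pmatrix}.$$ For $G=\mathbb R^r$ the basis of $\mathfrak g=\mathbb R^r$ is the standard one, coming from the coordinates $\epsilon_1,\dots,\epsilon_r$. *)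

(* Defs.v *)
From HB Require Import structures.
From mathcomp Require Import all_boot all_order all_algebra.
From mathcomp Require Import all_classical all_reals all_analysis.

Set Implicit Arguments.
Unset Strict Implicit.
Unset Printing Implicit Defensive.

Import Order.TTheory GRing.Theory Num.Theory.
Import numFieldNormedType.Exports.

Local Open Scope classical_set_scope.
Local Open Scope ring_scope.

Section Smooth.
Variables (R : realType) (V W : normedModType R).

Fixpoint Ck (k : nat) (f : V -> W) : Prop :=
  match k with
  | 0 => continuous f
  | k'.+1 => continuous f /\
      forall v, (forall x, derivable f x v) /\ Ck k' (fun x => 'D_v f x)
  end.

Definition smooth (f : V -> W) : Prop := forall k, Ck k f.

Lemma is_derive_affine (f L : V -> W) (x v : V) :
  (forall (h : R) y w, f (h *: w + y) = h *: L w + f y) ->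
  is_derive x v f (L v).
Proof.
move=> fL.
have cvgL : h^-1 *: (f (h *: v + x) - f x) @[h --> (0 : R)^'] --> L v.
  apply: cvg_near_cst; near=> h.
  rewrite fL addrK scalerA mulVf ?scale1r//.
  by near: h; exact: nbhs_dnbhs_neq.
apply: DeriveDef; first by apply/cvg_ex; exists (L v).
exact: (cvg_lim _ cvgL).
Unshelve. all: by end_near. Qed.

Lemma smooth_cst (a : W) : smooth (cst a).
Proof.
move=> k; elim: k a => [|k IH] a /=; first exact: cst_continuous.
split=> [|v]; first exact: cst_continuous.
split=> [x|]; first exact: derivable_cst.
rewrite (_ : (fun x => _) = cst 0); first exact: IH.
by apply/funext => x; rewrite derive_cst.
Qed.

Lemma smooth_affine (f L : V -> W) : continuous f ->
  (forall (h : R) y w, f (h *: w + y) = h *: L w + f y) -> smooth f.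
Proof.
move=> fc fL [|k] //=; split=> // v.
have dfL x := is_derive_affine x v fL.
split=> [x|]; first exact: (@ex_derive _ _ _ _ _ _ _ (dfL x)).
rewrite (_ : (fun x => _) = cst (L v)); first exact: smooth_cst.
by apply/funext => x; exact: (@derive_val _ _ _ _ _ _ _ (dfL x)).
Qed.

End Smooth.

(* Lie groups and manifolds are those covered by one global chart, so that
   the underlying set is R^n and tangent vectors are row vectors. *)
Record lie_group (R : realType) (n : nat) := LieGroup {
  lg_mul : 'rV[R]_n -> 'rV[R]_n -> 'rV[R]_n;
  lg_one : 'rV[R]_n;
  lg_inv : 'rV[R]_n -> 'rV[R]_n;
  lg_mulA : associative lg_mul;
  lg_mul1 : left_id lg_one lg_mul;
  lg_mulV : left_inverse lg_one lg_inv lg_mul;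
  lg_mul_smooth : smooth (fun g : 'rV[R]_n * 'rV[R]_n => lg_mul g.1 g.2);
  lg_inv_smooth : smooth lg_inv
}.

Record lie_action (R : realType) (r p : nat) (G : lie_group R r) := LieAction {
  la_act : 'rV[R]_r -> 'rV[R]_p -> 'rV[R]_p;
  la_act1 : forall z, la_act (lg_one G) z = z;
  la_actM : forall g h z, la_act (lg_mul G g h) z = la_act g (la_act h z);
  la_smooth : smooth (fun x : 'rV[R]_r * 'rV[R]_p => la_act x.1 x.2)
}.
Arguments lie_action {R r} p G.

Section LieAlgebra.
Variables (R : realType) (r : nat) (G : lie_group R r).

(* The Lie algebra is the tangent space 'rV[R]_r at lg_one G, identified with
   the left-invariant vector fields. *)
Definition left_invariant_field (v : 'rV[R]_r) : 'rV[R]_r -> 'rV[R]_r :=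
  fun g => 'D_v (lg_mul G g) (lg_one G).

Definition field_bracket (X Y : 'rV[R]_r -> 'rV[R]_r) : 'rV[R]_r -> 'rV[R]_r :=
  fun g => 'D_(X g) Y g - 'D_(Y g) X g.

Definition lie_bracket (v w : 'rV[R]_r) : 'rV[R]_r :=
  field_bracket (left_invariant_field v) (left_invariant_field w) (lg_one G).

Definition one_param_subgroup (v : 'rV[R]_r) (phi : R -> 'rV[R]_r) : Prop :=
  [/\ smooth phi,
      forall s t, phi (s + t) = lg_mul G (phi s) (phi t) &
      is_derive (0 : R) (1 : R) phi v].

(* The one-parameter subgroup with velocity v exists and is unique; xget
   selects it, and the default value cst (lg_one G) is never used. *)
Definition lie_exp (v : 'rV[R]_r) : 'rV[R]_r :=
  xget (cst (lg_one G)) [set phi | one_param_subgroup v phi] 1.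

Definition structure_constant (b : r.-tuple 'rV[R]_r) (i j k : 'I_r) : R :=
  coord b k (lie_bracket (tnth b i) (tnth b j)).

Definition dual_coord (b : r.-tuple 'rV[R]_r) (i : 'I_r)
    (theta : 'Hom('rV[R]_r, R^o)) : R :=
  theta (tnth b i).

Definition lie_poisson_matrix (b : r.-tuple 'rV[R]_r)
    (theta : 'Hom('rV[R]_r, R^o)) : 'M[R]_r :=
  \matrix_(i, j) \sum_(k < r) structure_constant b i j k * dual_coord b k theta.

Definition infinitesimals (p : nat) (A : lie_action p G)
    (b : r.-tuple 'rV[R]_r) (z : 'rV[R]_p) : 'M[R]_(p, r) :=
  \matrix_(l, k) derive1 (fun t : R => la_act A (lie_exp (t *: tnth b k)) z 0 l) 0.

Definition poisson_structure_matrix (p : nat) (A : lie_action p G)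
    (b : r.-tuple 'rV[R]_r) (z : 'rV[R]_p) (theta : 'Hom('rV[R]_r, R^o)) :
    'M[R]_(p + r) :=
  block_mx 0 (infinitesimals A b z)
           (- (infinitesimals A b z)^T) (lie_poisson_matrix b theta).

End LieAlgebra.

Section Translation.
Variables (R : realType) (r : nat).

Lemma smooth_add : smooth (fun g : 'rV[R]_r * 'rV[R]_r => g.1 + g.2).
Proof.
apply: (@smooth_affine _ _ _ _ (fun g => g.1 + g.2)).
  by move=> g; apply: cvgD; [exact: cvg_fst|exact: cvg_snd].
by move=> h y w /=; rewrite scalerDr addrACA.
Qed.

Lemma smooth_opp : smooth (fun g : 'rV[R]_r => - g).
Proof.
apply: (@smooth_affine _ _ _ _ (fun g => - g)); first exact: opp_continuous.
by move=> h y w; rewrite opprD scalerN.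
Qed.

Definition additive_lie_group : lie_group R r :=
  LieGroup (@addrA _) (@add0r _) (@addNr _) smooth_add smooth_opp.

Lemma translation_actM (g h z : 'rV[R]_r) : (g + h) + z = g + (h + z).
Proof. by rewrite addrA. Qed.

Definition translation_action : lie_action r additive_lie_group :=
  @LieAction R r r additive_lie_group (fun eps z => eps + z)
    (@add0r _) translation_actM smooth_add.

Definition std_basis : r.-tuple 'rV[R]_r :=
  [tuple (delta_mx 0 i : 'rV[R]_r) | i < r].

Lemma std_basisP : basis_of fullv std_basis.
Proof.
rewrite basisEdim size_tuple dimvf /dim /= mul1n leqnn andbT.
apply/subvP => v _; rewrite (row_sum_delta v) memv_suml// => i _.
have <- : tnth std_basis i = delta_mx 0 i by rewrite tnth_mktuple.
exact/memvZ/memv_span/mem_tnth.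
Qed.

End Translation.

(* Main.v *)
Require Import Defs.
From HB Require Import structures.
From mathcomp Require Import all_boot all_order all_algebra.
From mathcomp Require Import all_classical all_reals all_analysis.

Import GRing.Theory Num.Theory.
Import numFieldNormedType.Exports.
Local Open Scope ring_scope.

(* The exponential map of the additive group is the identity: a one-parameter
   subgroup phi with velocity v satisfies phi 1 = n *: phi (1 / n) for all
   n > 0, and the right-hand side tends to v. Hence the matrix of
   infinitesimals is the identity. Left-invariant fields are constant, so
   their brackets, and with them the structure constants, vanish. *)

Lemma additive_derive_at_1 (R : realType) (V : normedModType R)
    (phi : R -> V) (v : V) :
  (forall s t, phi (s + t) = phi s + phi t) ->
  is_derive (0 : R) (1 : R) phi v -> phi 1 = v.
Proof.
move=> phiD dphi.
have phi0 : phi 0 = 0 by apply: (addrI (phi 0)); rewrite -phiD !addr0.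
have phiMn n t : phi (t *+ n) = phi t *+ n.
  by elim: n => [|n IH]; rewrite ?mulr0n// !mulrS phiD IH.
have /cvg_ex[l dql] := @ex_derive _ _ _ _ _ _ _ dphi.
have lv : l = v.
  by rewrite -(@derive_val _ _ _ _ _ _ _ dphi); apply/esym/cvg_lim.
(* The terms 1 / (n + 1) are never zero, so the difference quotient of [phi] at 0 may be followed
   along them and still tends to [v]. *)
have h0 : (harmonic n @[n --> \oo] --> (0 : R)^')%classic.
  move=> A /(@cvg_harmonic R) [N _ nN]; exists N => // n /nN; apply.
  exact/lt0r_neq0/harmonic_gt0.
have := cvg_comp _ _ h0 dql; rewrite lv => dqv.
apply: (cvg_unique _ _ dqv) => //.
(* By additivity every such quotient, (n + 1) *: phi (1 / (n + 1)), equals [phi 1]. *)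
apply: cvg_near_cst; apply: nearW => n /=.
rewrite addr0 phi0 subr0 /harmonic /= invrK scaler_nat -phiMn.
by rewrite [_%:A]mulr1 -[_ *+ _]mulr_natr mulVf// pnatr_eq0.
Qed.

Section AdditiveGroup.
Variables (R : realType) (r : nat).
Local Notation G := (additive_lie_group R r).

(** The witness that keeps the [xget] in [lie_exp] from returning its default value. *)
Lemma one_param_subgroup_line (v : 'rV[R]_r) :
  one_param_subgroup G v (fun t => t *: v).
Proof.
have affine (h y w : R) : (h *: w + y) *: v = h *: (w *: v) + y *: v.
  by rewrite scalerDl scalerA.
split=> [|s t|]; last 2 first.
- exact: scalerDl.
- have := is_derive_affine (L := fun t : R => t *: v) (0 : R) (1 : R) affine.
  by rewrite scale1r.
- apply: (smooth_affine (L := fun t : R => t *: v)) => //.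
  exact: scalel_continuous.
Qed.

Lemma lie_exp_additive (v : 'rV[R]_r) : lie_exp G v = v.
Proof.
rewrite /lie_exp; case: xgetP => [phi _ [_ phiD dphi]|].
  exact: additive_derive_at_1 phiD dphi.
by move=> /(_ _ (one_param_subgroup_line v)).
Qed.

Lemma left_invariant_field_additive (v : 'rV[R]_r) :
  left_invariant_field G v = cst v.
Proof.
apply/funext => g.
(* Left translation by [g] is affine with linear part [id], whatever [g] is. *)
apply: (@derive_val _ _ _ _ _ _ _ (is_derive_affine (L := id) _ _ _)).
by move=> h y w /=; rewrite addrCA.
Qed.

Lemma lie_bracket_additive (v w : 'rV[R]_r) : lie_bracket G v w = 0.
Proof.
by rewrite /lie_bracket /field_bracket !left_invariant_field_additive
  !derive_cst subrr.
Qed.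

Lemma lie_poisson_matrix_additive (b : r.-tuple 'rV[R]_r)
    (theta : 'Hom('rV[R]_r, R^o)) : lie_poisson_matrix G b theta = 0.
Proof.
apply/matrixP => i j; rewrite !mxE big1// => k _.
by rewrite /structure_constant lie_bracket_additive linear0 mul0r.
Qed.

Lemma infinitesimals_translation (z : 'rV[R]_r) :
  infinitesimals (translation_action R r) (std_basis R r) z = 1%:M.
Proof.
apply/matrixP => l k; rewrite !mxE tnth_mktuple derive1E.
under eq_fun do rewrite lie_exp_additive /= !mxE.
(* Gives the right-hand side the form [L 1], the derivative in direction 1 of an affine map with
   linear part [L]. *)
rewrite -[RHS]mul1r.
apply: (@derive_val _ _ _ _ _ _ _
  (is_derive_affine (L := fun t : R => t * (l == k)%:R) _ _ _)).
by move=> h y w; rewrite eqxx /= mulrDl -mulrA addrA.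
Qed.

End AdditiveGroup.

Theorem corollary2p16 (R : realType) (r : nat)
    (z : 'rV[R]_r) (theta : 'Hom('rV[R]_r, R^o)) :
  poisson_structure_matrix (translation_action R r) (std_basis R r) z theta
  = block_mx 0 1%:M (- 1%:M) 0.
Proof.
by rewrite /poisson_structure_matrix infinitesimals_translation
  lie_poisson_matrix_additive trmx1.
Qed.
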